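(* Assume the Continuum Hypothesis. Let $\mathcal{U}$ be a non-principal ultrafilter on $\mathbb{N}$. For every $\mathcal{U}$-indivisible $(\aleph_0,\aleph_1)$-graph $G$ there exists a $\mathcal{U}$-indivisible $(\aleph_0,\aleph_1)$-graph $H$ such that $G$ is not a minor of $H$.
   Context: An $(\aleph_0,\aleph_1)$-graph is a bipartite graph with bipartition $(A,B)$, $|A|=\aleph_0$, $|B|=\aleph_1$, every vertex of $B$ of infinite degree. For a non-principal ultrafilter $\mathcal{U}$ on $\mathbb{N}$, an $(\aleph_0,\aleph_1)$-graph with bipartition $(\mathbb{N},B)$ is $\mathcal{U}$-indivisible if for every $A\in\mathcal{U}$, the set $N(b)\setminus A$ is finite for all but countably many $b\in B$ (where $N(b)$ is the neighbourhood of $b$). A graph $H'$ is a minor of $H$ if to each vertex $x$ of $H'$ one can assign a connected set $V_x\subseteq V(H)$, pairwise disjoint, such that $H$ has a $V_x$–$V_y$ edge whenever $xy\in E(H')$. *)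

(* Defs.v *)
From Stdlib Require Import Relation_Operators.
From mathcomp Require Import all_boot.
From mathcomp Require Import boolp classical_sets functions cardinality filter.

Set Implicit Arguments.
Unset Strict Implicit.
Unset Printing Implicit Defensive.

Local Open Scope classical_set_scope.
Local Open Scope card_scope.

(** [A] has cardinality aleph_1: it is a least uncountable cardinal. *)
Definition is_aleph1 (T : Type) (A : set T) : Prop :=
  ~ countable A /\
  forall (S : Type) (C : set S), ~ countable C -> A #<= C.

(** 2^aleph_0 = aleph_1. *)
Definition continuum_hypothesis : Prop := is_aleph1 [set: set nat].

(** Simple undirected graphs, finite or infinite. *)
Record graph (V : Type) := Graph {
  edge : V -> V -> Prop;
  edge_sym : forall x y, edge x y -> edge y x;
  edge_irrefl : forall x, ~ edge x x
}.

Definition nbhd (V : Type) (G : graph V) (v : V) : set V :=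
  [set w | edge G v w].

Definition bipartition (V : Type) (G : graph V) (A B : set V) : Prop :=
  [/\ A `|` B = setT,
      A `&` B = set0,
      (forall x y, A x -> A y -> ~ edge G x y) &
      (forall x y, B x -> B y -> ~ edge G x y)].

Definition aleph0_aleph1_graph (V : Type) (G : graph V) (A B : set V) : Prop :=
  [/\ bipartition G A B,
      A #= [set: nat],
      is_aleph1 B &
      forall b, B b -> infinite_set (nbhd G b)].

(** Connectedness of the subgraph induced on [W]; as usual, connected graphs
    are nonempty. *)
Definition connected_in (V : Type) (G : graph V) (W : set V) : Prop :=
  W !=set0 /\
  forall x y, W x -> W y ->
    clos_refl_trans V (fun u v => [/\ W u, W v & edge G u v]) x y.

Definition minor (V' V : Type) (H' : graph V') (H : graph V) : Prop :=
  exists W : V' -> set V,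
    [/\ forall x, connected_in H (W x),
        forall x y, x <> y -> W x `&` W y = set0 &
        forall x y, edge H' x y ->
          exists u v, [/\ W x u, W y v & edge H u v]].

Definition nonprincipal (T : Type) (U : set_system T) : Prop :=
  forall x, U <> principal_filter x.

(** Graphs with bipartition (N, B) live on the vertex type [nat + B], so that
    N and B are the ranges of [inl] and [inr]. *)
Definition indivisible (U : set_system nat) (B : Type)
    (G : graph (nat + B)) : Prop :=
  aleph0_aleph1_graph G (range inl) (range inr) /\
  forall A : set nat, U A ->
    countable [set b : B |
      infinite_set (nbhd G (inr b) `\` (inl @` A))].

(* Main.v *)
(** Under CH, take the members [A] of the ultrafilter [U] in order type omega_1
    and let the neighbourhoods [N alpha] of [H] diagonalise them: [N alpha] is
    almost contained in every earlier [A], which makes [H] indivisible, and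
    almost contains no neighbourhood of [G].  The latter is possible because
    [N alpha] can be found inside a set outside [U], so that all but countably
    many neighbourhoods of [G] are avoided automatically.

    If [G] were a minor of [H], all but countably many vertices [b] on the
    uncountable side of [G] would have a single vertex [f b] of [H] as branch
    set, and the branch sets of the natural numbers would give a map [h] on the
    naturals such that the image of [N (f b)] under [h] contains the
    neighbourhood of [b].  On some [A] in [U], either [h] is the identity, and
    [N (f b)] almost contains the neighbourhood of [b], or [h] maps [A] off
    itself, and the neighbourhood of [b], almost contained in [A], is almost
    disjoint from [A]. *)

From Stdlib Require Import Relation_Operators.
Require Import Defs.
From mathcomp Require Import all_boot.
From mathcomp Require Import boolp classical_sets functions cardinality filter.
From mathcomp Require wochoice.

Set Implicit Arguments.
Unset Strict Implicit.
Unset Printing Implicit Defensive.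

Local Open Scope classical_set_scope.
Local Open Scope card_scope.

(** * Infinite sets of naturals and countable sets *)

Lemma infinite_range (T : Type) (s : nat -> T) :
  injective s -> infinite_set (range s).
Proof.
move=> s_inj; rewrite (eq_finite_set (inj_card_eq (in2W s_inj))).
exact: infinite_nat.
Qed.

Lemma infinite_image (S T : Type) (f : S -> T) (A : set S) :
  injective f -> infinite_set (f @` A) <-> infinite_set A.
Proof. by move=> f_inj; rewrite (eq_finite_set (inj_card_eq (in2W f_inj))). Qed.

Lemma infinite_unbounded (A : set nat) (m : nat) :
  infinite_set A -> exists2 n, A n & m < n.
Proof.
move=> infA; apply: contrapT => noA; apply: infA.
apply: (@sub_finite_set _ _ `I_m.+1); last exact: finite_II.
move=> n An /=; rewrite ltnS leqNgt; apply/negP => mn.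
by apply: noA; exists n.
Qed.

Lemma enumeration (T : Type) (F : set T) (x0 : T) : countable F ->
  exists e : nat -> T,
    (forall n, (x0 |` F) (e n)) /\ (forall x, F x -> exists n, e n = x).
Proof.
move=> /countable_injP[f f_inj].
have /choice[e eP] n : exists y, (x0 |` F) y /\
    forall x, F x -> f x = n -> y = x.
  have [[x [Fx fx]]|noF] := pselect (exists x, F x /\ f x = n).
    exists x; split; first by right.
    by move=> y Fy fy; apply: f_inj; rewrite ?inE// fx.
  by exists x0; split; [left|move=> x Fx fx; case: noF; exists x].
exists e; split=> [n|x Fx]; first by have [] := eP n.
by exists (f x); apply: (eP (f x)).2.
Qed.

Lemma increasing_selection (S : nat -> set nat) :
  (forall k, infinite_set (S k)) ->
  exists s : nat -> nat, (forall k, S k (s k)) /\ {homo s : i j / i < j}.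
Proof.
move=> infS.
have /choice[f fP] (km : nat * nat) : exists n, S km.1 n /\ km.2 < n.
  by have [n Sn mn] := infinite_unbounded km.2 (infS km.1); exists n.
pose s := fix s k := if k is k'.+1 then f (k, s k') else f (0, 0).
exists s; split=> [[|k]|]; [exact: (fP (_, _)).1 .. |].
by apply: homo_ltn => [? ? ?|k]; [exact: ltn_trans | exact: (fP (_, _)).2].
Qed.

Lemma homo_ltn_inj (s : nat -> nat) : {homo s : i j / i < j} -> injective s.
Proof.
move=> sm i j; case: (ltngtP i j) => // /sm + sij; by rewrite sij ltnn.
Qed.

(** One increasing sequence is chosen: its even terms lie in [M] and form [N], its odd terms visit
    every member of [C] infinitely often and, by injectivity, miss [N]. *)
Lemma evasive_subset (M : set nat) (C : set (set nat)) :
  infinite_set M -> countable C -> (forall X, C X -> infinite_set X) ->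
  exists N, [/\ N `<=` M, infinite_set N &
    forall X, C X -> infinite_set (X `\` N)].
Proof.
move=> infM /(enumeration setT)[e [eC Ce]] infC.
(* [k./2] codes a pair: the first entry picks a member of [C], the second makes it recur. The
   default [(0, 0)] is harmless, as every [e n] is infinite. *)
pose S k := if odd k then e (odflt (0, 0) (unpickle k./2)).1 else M.
have [k|s [sS s_mono]] := @increasing_selection S.
  rewrite /S; case: ifP => // _.
  have [->|/infC//] := eC (odflt (0, 0) (unpickle k./2)).1.
  exact: infinite_nat.
have s_inj := homo_ltn_inj s_mono.
exists (range (fun k => s k.*2)); split.
- by move=> _ [k _ <-]; have := sS k.*2; rewrite /S odd_double.
- by apply: infinite_range => i j /s_inj /double_inj.
move=> X /Ce[k <-].
apply: (@sub_infinite_set _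
  (range (fun n => s (pickle (k, n)).*2.+1))); last first.
  apply: infinite_range => i j /s_inj[/double_inj /(pcan_inj (@pickleK _))].
  by case.
move=> _ [n _ <-]; split.
  have := sS (pickle (k, n)).*2.+1.
  by rewrite /S /= odd_double /= uphalf_double pickleK.
by move=> [j _ /s_inj /(congr1 odd)]; rewrite /= !odd_double.
Qed.

Lemma countableU (T : Type) (A B : set T) :
  countable A -> countable B -> countable (A `|` B).
Proof.
move=> cA cB.
have: countable (\bigcup_(b in [set: bool]) if b then A else B).
  by apply: bigcup_countable => // -[].
apply: sub_countable; apply: subset_card_le => y [?|?]; by [exists true|exists false].
Qed.

(** A well-order of [T] may be longer than omega_1, so it is cut down to the set [C] of points with
    countable initial segment. [C] is uncountable: otherwise the least point outside it would have a
    countable segment. By minimality of aleph_1, [T] injects into [C], and the order is pulled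
    back. *)
Lemma countable_segments (T : Type) : is_aleph1 [set: T] ->
  exists2 R : T -> T -> Prop,
    forall x y, R x y \/ R y x & forall y, countable [set x | R x y].
Proof.
elim/Ppointed: T => T [uncT leT]; first by case: uncT; rewrite emptyE.
have [L woL] := wochoice.well_ordering_principle T.
have L_total x y : L x y \/ L y x.
  have [|z [[zxy minz] _]] := woL (pred2 x y).
    by exists x; rewrite inE eqxx.
  move: zxy; rewrite inE => /orP[]/eqP zE; [left|right];
    by rewrite -zE; apply: minz; rewrite inE eqxx ?orbT.
have L_refl x : L x x by case: (L_total x x).
have L_anti x y : L x y -> L y x -> x = y.
  move=> Lxy Lyx.
  have [|z [_ uz]] := woL (pred2 x y).
    by exists x; rewrite inE eqxx.
  by rewrite -(uz x) ?(uz y) //; split; rewrite ?inE ?eqxx ?orbT // => t;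
    rewrite inE => /orP[]/eqP->.
pose C := [set x | countable [set y | L y x]].
have uncC : ~ countable C.
  move=> cC.
  have [[x nCx]|allC] := pselect (exists x, ~ C x); last first.
    apply: uncT; apply: sub_countable cC; apply: subset_card_le => x _.
    by apply: contrapT => nCx; apply: allC; exists x.
  have [|z [[znC minz] _]] := woL [pred x | ~~ `[<C x>]].
    by exists x; rewrite inE; apply/asboolPn.
  move: znC; rewrite inE => /asboolPn; apply.
  apply: sub_countable (countableU (countable1 z) cC).
  apply: subset_card_le => y /= Lyz.
  have [|nCy] := pselect (C y); [by right | left].
  by apply: L_anti => //; apply: minz; rewrite inE; apply/asboolPn.
have /pcard_leP[i] := leT _ _ uncC.
exists (fun x y => L (i x) (i y)) => // y.
have : countable [set x | L x (i y)] by apply: (@funS _ _ _ _ i y).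
apply: sub_countable; apply: (@card_ge_preimage _ _ [set x | L x (i y)] i).
by move=> u v _ _; apply: inj; rewrite inE.
Qed.

(** * Free ultrafilters on the naturals *)

Section FreeUltrafilter.
Variable U : set_system nat.
Hypotheses (U_ultra : UltraFilter U) (U_free : nonprincipal U).

Lemma ultra_disjoint (A B : set nat) : U A -> U B -> A `&` B !=set0.
Proof. by move=> UA UB; apply: filter_ex (filterI UA UB). Qed.

Lemma free_ultrafilter_tail (m : nat) : U [set n | m <= n].
Proof.
elim: m => [|m IHm]; first by apply: filterS filterT => n _.
have [Um|UCm] := in_ultra_setVsetC [set m] U_ultra; last first.
  apply: filterS (filterI IHm UCm) => n [/= mn nm].
  by rewrite ltn_neqAle mn andbT eq_sym; apply/eqP.
case: (U_free (x := m)); apply/seteqP; split=> A; last first.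
  by move=> /principal_filterP Am; apply: filterS Um => _ ->.
move=> UA; apply/principal_filterP.
by have [_ [/[swap] ->]] := ultra_disjoint UA Um.
Qed.

Lemma free_ultrafilter_infinite (A : set nat) : U A -> infinite_set A.
Proof.
move=> UA /finite_seqP[s sA].
have [n [An]] := ultra_disjoint UA (free_ultrafilter_tail (\max_(x <- s) x).+1).
rewrite /= ltnNge => /negP; apply.
by move: An; rewrite sA /= => ns; rewrite leq_bigmax_seq.
Qed.

(** The [k]-th term of an increasing sequence is taken in the first [k.+1] sets, so only the terms
    before it can miss [e k]. *)
Lemma pseudo_intersection (F : set (set nat)) : countable F -> F `<=` U ->
  exists2 M, infinite_set M & forall A, F A -> finite_set (M `\` A).
Proof.
move=> /(enumeration setT)[e [eF Fe]] FU.
have Ue n : U (e n) by have [->|/FU//] := eF n; apply: filterT.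
have [k|s [sS s_mono]] :=
    @increasing_selection (fun k => \bigcap_(i < k.+1) e i).
  apply: free_ultrafilter_infinite.
  elim: k => [|k IHk].
    by apply: filterS (Ue 0) => x ex [].
  apply: filterS (filterI IHk (Ue k.+1)) => x [xk ek] i /=.
  by rewrite ltnS leq_eqVlt => /orP[/eqP-> //|]; apply: xk.
exists (range s); first exact/infinite_range/homo_ltn_inj.
move=> _ /Fe[k <-].
apply: (@sub_finite_set _ _ (s @` `I_k)); last exact/finite_image/finite_II.
move=> _ [[i _ <-] nei]; exists i => //=.
by rewrite ltnNge; apply/negP => ki; apply: nei; apply: (sS i).
Qed.

(** Two disjoint infinite subsets of [M] cannot both belong to [U]. *)
Lemma infinite_null_subset (M : set nat) : infinite_set M ->
  exists N, [/\ N `<=` M, infinite_set N & U (~` N)].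
Proof.
move=> infM.
have [//|s [sM s_mono]] := @increasing_selection (fun=> M).
have s_inj := homo_ltn_inj s_mono.
pose N b := range (fun k => s (b + k.*2)).
have NM b : N b `<=` M by move=> _ [k _ <-]; apply: sM.
have infN b : infinite_set (N b).
  by apply: infinite_range => i j /s_inj /addnI /double_inj.
have [UN|] := in_ultra_setVsetC (N 0) U_ultra; last by exists (N 0).
exists (N 1); split => //; apply: filterS UN => _ [i _ <-] [j _] /s_inj.
by move=> /(congr1 odd); rewrite !oddD !odd_double.
Qed.

(** [N] is sought inside a pseudo-intersection [M] whose complement is in [U]. All but countably
    many [K b] meet [M] in a finite set; [evasive_subset] handles the others. *)
Lemma evasive_pseudo_intersection (B : Type) (K : B -> set nat)
    (F : set (set nat)) :
  countable F -> F `<=` U -> (forall b, infinite_set (K b)) ->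
  (forall A, U A -> countable [set b | infinite_set (K b `\` A)]) ->
  exists N, [/\ infinite_set N, forall A, F A -> finite_set (N `\` A) &
    forall b, infinite_set (K b `\` N)].
Proof.
move=> cF FU infK indivK.
have [M0 infM0 M0F] := pseudo_intersection cF FU.
have [M [MM0 infM UM]] := infinite_null_subset infM0.
have [||N [NM infN NK]] := evasive_subset infM
    (C := K @` [set b | infinite_set (K b `\` ~` M)]).
- exact: sub_countable (card_image_le _ _) (indivK _ UM).
- by move=> _ [b _ <-].
exists N; split => // [A /M0F|b].
  by apply: sub_finite_set => x [/NM/MM0 ? ?]; split.
have [bM|bM] := pselect (infinite_set (K b `\` ~` M)).
  by apply: NK; exists b.
have {}bM : finite_set (K b `\` ~` M) by apply: contrapT.
apply: sub_infinite_set (infinite_setD (infK b) bM) => x [Kx nx].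
by split=> // /NM Mx; apply: nx; split.
Qed.

(* The colour of [a] is the [U]-limit of the parities of [c n a]. *)
Lemma ultra_coloring (h : nat -> nat) (A0 : set nat) (c : nat -> nat -> nat) :
  U A0 -> (forall a, A0 a -> \forall n \near U, c n a = (c n (h a)).+1) ->
  exists2 A, U A & forall a, A a -> ~ A (h a).
Proof.
move=> UA0 ch; pose P := [set a | U [set n | odd (c n a)]].
have hP a : A0 a -> P a <-> ~ P (h a).
  move=> /ch cha; split.
    move=> Pa Pha; have [n [[/= -> /=]]] := ultra_disjoint (filterI cha Pa) Pha.
    by move=> /negP.
  move=> nPha; have [//|ev] :=
    in_ultra_setVsetC [set n | odd (c n (h a))] U_ultra.
  apply: filterS (filterI cha ev) => n /= [-> /negP].
  by rewrite /=.
have [UP|UP] := in_ultra_setVsetC P U_ultra.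
  by exists (A0 `&` P); [exact: filterI | move=> a [/hP hPa /hPa nP] []].
exists (A0 `&` ~` P); first exact: filterI.
by move=> a [/hP hPa nPa] [_ /hPa].
Qed.

(* The sum below is the time that the orbit of [a] spends in [p n]; starting
   from [h a] instead of [a] lowers it by one. *)
Lemma ultra_displaced (h : nat -> nat) (A0 : set nat) (p : nat -> pred nat) :
  U A0 -> (forall a n, A0 a -> a < n -> p n a) ->
  (forall a n, a < n -> ~~ p n (iter n h a)) ->
  exists2 A, U A & forall a, A a -> ~ A (h a).
Proof.
move=> UA0 p0 pn.
apply: (@ultra_coloring h A0 (fun n a => \sum_(t < n) p n (iter t h a))) => //.
move=> a Aa; apply: filterS (free_ultrafilter_tail a.+1) => -[//|n] /= an.
rewrite big_ord_recl big_ord_recr /= p0 // -iterSr (negPf (pn _ _ an)) addn0.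
by rewrite add1n; congr _.+1; apply: eq_bigr => i _; rewrite -iterSr.
Qed.

(** On a set in [U], [h] fixes, raises or lowers every point. In the last two cases [h] is altered
    off that set so that all orbits climb, or descend to 0, as [ultra_displaced] requires. *)
Lemma ultra_fixed_or_displaced (h : nat -> nat) : exists2 A, U A &
  (forall a, A a -> h a = a) \/ (forall a, A a -> ~ A (h a)).
Proof.
have transfer (k : nat -> nat) A0 : U A0 -> (forall a, A0 a -> k a = h a) ->
    (exists2 A, U A & forall a, A a -> ~ A (k a)) ->
    exists2 A, U A & (forall a, A a -> h a = a) \/ (forall a, A a -> ~ A (h a)).
  move=> UA0 kh [A UA Ak]; exists (A0 `&` A); first exact: filterI.
  by right=> a [Aa /Ak +] [_]; rewrite kh.
have [Ufix|Umove] := in_ultra_setVsetC [set a | h a = a] U_ultra.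
  by exists [set a | h a = a] => //; left.
have [Uup|Udown] := in_ultra_setVsetC [set a | a < h a] U_ultra.
  apply: (transfer (fun a => maxn a.+1 (h a)) _ Uup) => [a /= /maxn_idPr//|].
  apply: (@ultra_displaced _ setT (fun n x => x < n)) => [|//|a n _].
    exact: filterT.
  rewrite -leqNgt; elim: n => //= n IHn.
  by rewrite leq_max ltnS IHn.
have UA0 : U [set a | h a < a].
  apply: filterS (filterI Umove Udown) => a [/= /eqP ha /negP].
  by rewrite -leqNgt leq_eqVlt (negPf ha).
(* With [a.-1] as a cap, the orbit of [a] reaches 0 within [a] steps and stays there; [leq 1] holds
   exactly off 0. *)
apply: (transfer (fun a => minn a.-1 (h a)) _ UA0).
  by move=> [|a] //= ha; apply/minn_idPr; rewrite -ltnS.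
apply: (@ultra_displaced _ _ (fun=> leq 1) UA0) => [a n ha _|a n an].
  exact: leq_ltn_trans ha.
suff: iter n (fun a => minn a.-1 (h a)) a <= a - n.
  by rewrite -leqNgt => /leq_trans -> //; rewrite leq_subLR addn0 ltnW.
elim: {an}n => [|n IHn] /=; first by rewrite subn0.
by rewrite geq_min subnS -!subn1 leq_sub2r.
Qed.

End FreeUltrafilter.

(** * Bipartite graphs from families of sets, and their minors *)

Definition trace (B : Type) (G : graph (nat + B)) (b : B) : set nat :=
  [set n | edge G (inr b) (inl n)].

Section BipartiteGraph.
Variables (B : Type) (N : B -> set nat).

Definition bipartite_edge (u v : nat + B) : Prop :=
  match u, v with
  | inl n, inr b | inr b, inl n => N b n
  | _, _ => False
  end.

Lemma bipartite_edge_sym u v : bipartite_edge u v -> bipartite_edge v u.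
Proof. by case: u; case: v. Qed.

Lemma bipartite_edge_irrefl u : ~ bipartite_edge u u.
Proof. by case: u => ? []. Qed.

Definition bipartite_graph : graph (nat + B) :=
  Graph bipartite_edge_sym bipartite_edge_irrefl.

Lemma bipartite_nbhd b : nbhd bipartite_graph (inr b) = inl @` N b.
Proof.
by apply/seteqP; split=> [[n Nn|c []]|_ [n Nn <-]] //; exists n.
Qed.

Lemma indivisible_bipartite_graph (U : set_system nat) :
  is_aleph1 [set: B] -> (forall b, infinite_set (N b)) ->
  (forall A, U A -> countable [set b | infinite_set (N b `\` A)]) ->
  indivisible U bipartite_graph.
Proof.
move=> [uncB leB] infN indivN.
have inl_inj : injective (@inl nat B) by move=> ? ? [].
have inr_inj : injective (@inr nat B) by move=> ? ? [].
have inrT := inj_card_eq (in2W inr_inj : {in [set: B] &, injective inr}).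
split; first split.
- split.
  + by apply/seteqP; split=> // -[n|b] _; [left; exists n|right; exists b].
  + by apply/seteqP; split=> // _ [[n _ <-] [b _]].
  + by move=> _ _ [n _ <-] [m _ <-].
  + by move=> _ _ [n _ <-] [m _ <-].
- exact: inj_card_eq (in2W inl_inj).
- split; first by rewrite (eq_countable inrT).
  by move=> S C uncC; rewrite (card_le_eql inrT); apply: leB.
- by move=> _ [b _ <-]; rewrite bipartite_nbhd; apply/infinite_image.
move=> A /indivN; apply: sub_countable; apply: subset_card_le => b /=.
rewrite bipartite_nbhd; apply: contra_not => /(finite_image (@inl nat B)).
by apply: sub_finite_set => _ [[n Nn <-] nA]; exists n => //; split=> // An;
  apply: nA; exists n.
Qed.

(* [D] collects the [c] whose branch set meets the countable side of [H]; any
   other branch set is a single vertex [f c], as the side [B] is independent. *)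
Lemma minor_bipartite_trace (C : Type) (G : graph (nat + C)) (b0 : B) :
  minor G bipartite_graph ->
  exists (f : C -> B) (h : nat -> nat) (D : set C),
    [/\ countable D, {in ~` D &, injective f} &
      forall c, ~ D c -> trace G c `<=` h @` N (f c)].
Proof.
move=> [W [connW disjW edgeW]].
have W_inj x y u : W x u -> W y u -> x = y.
  move=> Wx Wy; apply: contrapT => /disjW W0.
  by have : set0 u by rewrite -W0.
pose D := [set c | exists n, W (inr c) (inl n)].
have sing c : ~ D c -> exists b, W (inr c) = [set inr b].
  move=> nDc.
  have [[[n|b] Wb] conn] := connW (inr c); first by case: nDc; exists n.
  have stuck u v : clos_refl_trans _ (fun u v =>
      [/\ W (inr c) u, W (inr c) v & edge bipartite_graph u v]) u v -> u = v.
    elim=> // [x y [Wx Wy]|x y z _ -> _ -> //].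
    by case: x y Wx Wy => [n|x] [m|y] //= Wx Wy _; case: nDc; [exists n|exists m].
  exists b; apply/seteqP; split=> [v Wv|_ ->//].
  by rewrite /= (stuck _ _ (conn _ _ Wv Wb)).
have /choice[f fP] c : exists b, ~ D c -> W (inr c) = [set inr b].
  have [Dc|/sing[b Wb]] := pselect (D c); [by exists b0 | by exists b].
(* [h] sends [m] to the [n] whose branch set contains it, unique by disjointness; the default [m]
   covers vertices in no such branch set. *)
exists f, (fun m => xget m [set n | W (inl n) (inl m)]), D; split.
- have /choice[g gP] c : exists n, D c -> W (inr c) (inl n).
    by have [[n Wn]|nDc] := pselect (D c); [exists n | exists 0].
  apply/countable_injP; exists g => c d; rewrite !inE => /gP Wc /gP Wd cd.
  by rewrite -cd in Wd; case: (W_inj _ _ _ Wc Wd).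
- move=> c d; rewrite !inE => /fP Wc /fP Wd cd.
  have Wc' : W (inr c) (inr (f c)) by rewrite Wc.
  have Wd' : W (inr d) (inr (f c)) by rewrite cd Wd.
  by case: (W_inj _ _ _ Wc' Wd').
move=> c nDc n /edgeW[u [v [Wu Wv]]]; move: Wu; rewrite (fP c nDc) => ->.
case: v Wv => [m|//] Wm Nm; exists m => //.
case: xgetP => [k _ /= Wk|/(_ n)//].
by case: (W_inj _ _ _ Wk Wm).
Qed.
End BipartiteGraph.

(** * The diagonal construction and the excluded minor *)

Theorem theorem6p2 :
  continuum_hypothesis ->
  forall U : set_system nat, UltraFilter U -> nonprincipal U ->
  forall (B : Type) (G : graph (nat + B)), indivisible U G ->
  exists (B' : Type) (H : graph (nat + B')),
    indivisible U H /\ ~ minor G H.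
Proof.
move=> CH U U_ultra U_free B G [[[_ _ _ indB] _ [uncB _] infB] indivG].
have inl_inj : injective (@inl nat B) by move=> ? ? [].
have traceE b : nbhd G (inr b) = inl @` trace G b.
  apply/seteqP; split=> [[n Gbn|c Gbc]|_ [n Gbn <-] //]; first by exists n.
  by case: (indB _ _ _ _ Gbc); [exists b|exists c].
have inf_trace b : infinite_set (trace G b).
  by apply/(infinite_image _ inl_inj); rewrite -traceE; apply: infB; exists b.
have indiv_trace A : U A -> countable [set b | infinite_set (trace G b `\` A)].
  move=> /indivG; apply: sub_countable; apply: subset_card_le => b /=.
  move=> /(infinite_image _ inl_inj); apply: sub_infinite_set.
  move=> _ [n [Gbn nAn] <-]; split=> // -[m Am [mn]].
  by apply: nAn; rewrite -mn.
(* Sets of naturals serve both as the sets to diagonalise against and, by CH, as the aleph_1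
   indices. *)
have [R R_total R_count] := countable_segments CH.
have /choice[N NP] (alpha : set nat) : exists N, [/\ infinite_set N,
    forall A, U A -> R A alpha -> finite_set (N `\` A) &
    forall b, infinite_set (trace G b `\` N)].
  have [||N [infN NF NG]] := evasive_pseudo_intersection U_ultra U_free
    (F := [set A | U A /\ R A alpha]) _ _ inf_trace indiv_trace.
  - by apply: sub_countable (R_count alpha); apply: subset_card_le => A [].
  - by move=> A [].
  by exists N; split=> // A UA RA; apply: NF.
have indivN A : U A -> countable [set alpha | infinite_set (N alpha `\` A)].
  move=> UA; apply: sub_countable (R_count A); apply: subset_card_le => x /=.
  have [_ Nx _] := NP x; have [RA|//] := R_total A x.
  by move=> []; apply: Nx.
exists (set nat), (bipartite_graph N); split.
  by apply: indivisible_bipartite_graph => // x; have [] := NP x.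
move=> /(minor_bipartite_trace set0)[f [h [D [cD f_inj traceh]]]].
have [A UA hA] := ultra_fixed_or_displaced U_ultra U_free h.
pose E := ~` D `&` f @^-1` [set x | infinite_set (N x `\` A)].
have cE : countable E.
  apply: sub_countable (indivN _ UA).
  have /inj_card_eq/card_eqPle[_ /card_le_trans] : {in E &, injective f}.
    by move=> x y; rewrite !inE => -[nDx _] [nDy _]; apply: f_inj; rewrite inE.
  by apply; apply: subset_card_le => _ [x [_ Nx] <-].
have [b [nDb Nfin Gfin]] : exists b, [/\ ~ D b, finite_set (N (f b) `\` A) &
    finite_set (trace G b `\` A)].
  apply: contrapT => nob; apply: uncB.
  apply: (sub_countable (card_image_le inr [set: B])).
  apply: sub_countable (countableU (countableU cD cE) (indiv_trace _ UA)).
  apply: subset_card_le => b _.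
  have [Db|nDb] := pselect (D b); first by left; left.
  have [Nb|Nb] := pselect (finite_set (N (f b) `\` A)); last by left; right.
  by right=> Gb; apply: nob; exists b.
have [_ _ /(_ b) infGN] := NP (f b).
(* If [h] is the identity on [A], this finite image contains the trace of [b] minus [N (f b)]; if
   [h] maps [A] off itself, it contains the part of the trace inside [A]. *)
have hfin := finite_image h Nfin.
case: hA => [hfix|hmove].
  apply: infGN; apply: sub_finite_set hfin => n [/(traceh _ nDb)[m Nm <-] nN].
  by exists m => //; split=> // /hfix hm; apply: nN; rewrite hm.
apply: (infinite_setD (inf_trace b) Gfin).
apply: sub_finite_set hfin => n [Gn nGn].
have [m Nm hm] := traceh _ nDb _ Gn; exists m => //; split=> // Am.
by apply: (hmove _ Am); rewrite hm; apply: contrapT => nA; apply: nGn.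
Qed.
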